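(* Let $\mathcal A$ be a finitely complete pointed category, let $F\colon\mathbb A\to\mathbb B$ be a functor between groupoids in $\mathcal A$, and let $\mathcal N(F)$ be its normalization in $\mathbf{Arr}(\mathcal A)$. \begin{enumerate} \item If $F$ is faithful, then $\mathcal N(F)$ is faithful. \item If $F$ is fully faithful, then $\mathcal N(F)$ is fully faithful. \item If $\mathcal A$ is regular and $F$ is full, then $\mathcal N(F)$ is full. \item If $\mathcal A$ is protomodular and $\mathcal N(F)$ is faithful, then $F$ is faithful. \item If $\mathcal A$ is protomodular and $\mathcal N(F)$ is fully faithful, then $F$ is fully faithful. \item If $\mathcal A$ is regular and protomodular and $\mathcal N(F)$ is full, then $F$ is full. \item If $\mathcal A$ is regular and protomodular and $F$ is essentially surjective, then $\mathcal N(F)$ is essentially surjective. \item If $\mathcal A$ is regular and $\mathcal N(F)$ is essentially surjective, then $F$ is essentially surjective. \item If $\mathcal A$ is regular and $F$ is a fibration, then $\mathcal N(F)$ is a fibration. \item If $\mathcal A$ is regular and protomodular and $\mathcal N(F)$ is a fibration, then $F$ is a fibration. \end{enumerate}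
   Context: Composition is written diagrammatically: $f\cdot g$ means first $f$, then $g$. Pointed means having a zero object $0$. For an arrow $f$, $k_f\colon\mathrm{Ker}(f)\to\cdot$ denotes its kernel. A finitely complete pointed category is protomodular if and only if the Split Short Five Lemma holds in it. **Internal groupoids.** A groupoid $\mathbb B$ in $\mathcal A$ has object of objects $B_0$, object of arrows $B_1$, domain and codomain $d,c\colon B_1\rightrightarrows B_0$, identities $e\colon B_0\to B_1$, composition $m\colon B_1\times_{c,d}B_1\to B_1$ and inverse $i\colon B_1\to B_1$, satisfying the usual axioms. A functor $F\colon\mathbb A\to\mathbb B$ is a pair $(F_0\colon A_0\to B_0,\ F_1\colon A_1\to B_1)$ compatible with the structure. **Classes of functors.** Let $F\colon\mathbb A\to\mathbb B$ be a functor. Let $A_0\times_{F_0,d}B_1\times_{c,F_0}A_0$ be the limit of $A_0\xrightarrow{F_0}B_0\xleftarrow{d}B_1\xrightarrow{c}B_0\xleftarrow{F_0}A_0$, and let $\partial(F)_0\colon A_1\to A_0\times_{F_0,d}B_1\times_{c,F_0}A_0$ be the arrow with components $d$, $F_1$, $c$. Let $A_0\times_{F_0,d}B_1$ be the pullback of $F_0$ and $d$, with projections $\alpha_d$ to $A_0$ and $\beta_d$ to $B_1$, and let $\tau_d\colon A_1\to A_0\times_{F_0,d}B_1$ be the arrow with components $d$ and $F_1$. - $F$ is faithful if $\partial(F)_0$ is a monomorphism; fully faithful if $\partial(F)_0$ is an isomorphism; and, when $\mathcal A$ is regular, full if $\partial(F)_0$ is a regular epimorphism. - When $\mathcal A$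 is regular, $F$ is essentially surjective if $\beta_d\cdot c\colon A_0\times_{F_0,d}B_1\to B_0$ is a regular epimorphism. - When $\mathcal A$ is regular, $F$ is a fibration if $\tau_d$ is a regular epimorphism. **The category $\mathbf{Arr}(\mathcal A)$.** Objects are arrows $a\colon A\to A_0$ of $\mathcal A$; morphisms $(f,f_0)\colon a\to b$, where $b\colon B\to B_0$, are pairs $f\colon A\to B$, $f_0\colon A_0\to B_0$ with $f\cdot b=a\cdot f_0$. Let $\partial(f,f_0)_0\colon A\to A_0\times_{f_0,b}B$ be the arrow into the pullback of $f_0$ and $b$ with components $a$ and $f$. The morphism $(f,f_0)$ is: - faithful if $\partial(f,f_0)_0$ is a monomorphism; fully faithful if $\partial(f,f_0)_0$ is an isomorphism; and, when $\mathcal A$ is regular, full if $\partial(f,f_0)_0$ is a regular epimorphism; - essentially surjective if $f_0$ and $b$ are jointly strongly epimorphic (every monomorphism into $B_0$ through which both $f_0$ and $b$ factor is an isomorphism); - a fibration, when $\mathcal A$ is regular, if $f$ is a regular epimorphism. **Normalization.** The normalization functor $\mathcal N\colon\mathbf{Grpd}(\mathcal A)\to\mathbf{Arr}(\mathcal A)$ sends a groupoid $\mathbb A$ to $k_d\cdot c\colon\mathrm{Ker}(d)\to A_1\to A_0$, where $k_d$ is the kernel of $d\colon A_1\to A_0$, and a functor $F\colon\mathbb A\to\mathbb B$ to the morphism $(\mathrm K_d(F),F_0)$, where $\mathrm K_d(F)$ is the arrow between the kernels of the domain maps determined by $\mathrm K_d(F)\cdot k_d=k_d\cdot F_1$. 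*)

(* Defs.v *)
(* Plain Rocq with the standard library only: categories are records whose
   hom-types are compared with Leibniz equality, and composition is written in
   diagrammatic order. *)
From Stdlib Require Import List Bool Eqdep_dec.
From Stdlib Require Export FinFun.

Set Implicit Arguments.
Unset Strict Implicit.
Unset Printing Implicit Defensive.

Reserved Notation "f · g" (at level 40, left associativity).

Record category := Category {
  ob :> Type;
  hom : ob -> ob -> Type;
  idm : forall X, hom X X;
  comp : forall X Y Z, hom X Y -> hom Y Z -> hom X Z;
  comp1m : forall X Y (f : hom X Y), comp (idm X) f = f;
  compm1 : forall X Y (f : hom X Y), comp f (idm Y) = f;
  compA : forall W X Y Z (f : hom W X) (g : hom X Y) (h : hom Y Z),
    comp f (comp g h) = comp (comp f g) h
}.
Arguments hom {_} _ _.
Arguments idm {_} _.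
Arguments comp {_ _ _ _} _ _.
Notation "f · g" := (comp f g).

Record functor (J C : category) := Functor {
  fob :> J -> C;
  fmap : forall i j, hom i j -> hom (fob i) (fob j);
  fmap_id : forall i, fmap (idm i) = idm (fob i);
  fmap_comp : forall i j k (u : hom i j) (v : hom j k),
    fmap (u · v) = fmap u · fmap v
}.

Record cone (J C : category) (D : functor J C) := Cone {
  apex : C;
  leg : forall j, hom apex (D j);
  leg_nat : forall i j (u : hom i j), leg i · fmap D u = leg j
}.

Record limit (J C : category) (D : functor J C) := Limit {
  lim_cone :> cone D;
  lim_lift : forall K : cone D, hom (apex K) (apex lim_cone);
  lim_liftE : forall (K : cone D) j, lim_lift K · leg lim_cone j = leg K j;
  lim_uniq : forall X (u v : hom X (apex lim_cone)),
    (forall j, u · leg lim_cone j = v · leg lim_cone j) -> u = v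
}.

Definition finite_category (J : category) : Prop :=
  Finite J /\ forall i j : J, Finite (hom i j).

Definition finite_limits (C : category) : Type :=
  forall J : category, finite_category J -> forall D : functor J C, limit D.

Record zero_object (C : category) := ZeroObject {
  zob : C;
  to_zob : forall X, hom X zob;
  to_zob_uniq : forall X (f : hom X zob), f = to_zob X;
  from_zob : forall X, hom zob X;
  from_zob_uniq : forall X (f : hom zob X), f = from_zob X
}.

(* Finitely complete pointed categories; limits and the zero object are
   chosen, so that pullbacks, kernels and the normalization are functions. *)
Record fcp_category := FCPCategory {
  fcp_cat :> category;
  fcp_lim : finite_limits fcp_cat;
  fcp_zero : zero_object fcp_cat
}.

Definition preorder_category (T : Type) (le : T -> T -> bool)
    (le_refl : forall x, le x x = true)
    (le_trans : forall x y z, le x y = true -> le y z = true -> le x z = true)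
  : category.
Proof.
refine (@Category T (fun x y => le x y = true) le_refl
  (fun x y z p q => le_trans x y z p q) _ _ _);
  intros; apply (UIP_dec bool_dec).
Defined.

Lemma Finite_is_true (b : bool) : Finite (b = true).
Proof.
destruct b.
- exists (eq_refl :: nil); intro h; left; apply (UIP_dec bool_dec).
- exists nil; intro h; discriminate h.
Qed.

Inductive cospan_ob := cs_left | cs_right | cs_base.

Definition cospan_le (x y : cospan_ob) : bool :=
  match x, y with
  | cs_left, cs_left | cs_right, cs_right | _, cs_base => true
  | _, _ => false
  end.

Definition cospan_shape : category.
Proof.
refine (@preorder_category cospan_ob cospan_le _ _).
- intros []; reflexivity.
- intros [] [] [] p q; solve [reflexivity | discriminate p | discriminate q].
Defined.

Lemma cospan_finite : finite_category cospan_shape.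
Proof.
split.
- exists (cs_left :: cs_right :: cs_base :: nil); intros []; simpl; tauto.
- intros i j; apply Finite_is_true.
Qed.

(* The shape  l -> bl <- m -> br <- r. *)
Inductive zigzag_ob := zz_l | zz_bl | zz_m | zz_br | zz_r.

Definition zigzag_le (x y : zigzag_ob) : bool :=
  match x, y with
  | zz_l, (zz_l | zz_bl) | zz_bl, zz_bl | zz_m, (zz_bl | zz_m | zz_br)
  | zz_br, zz_br | zz_r, (zz_br | zz_r) => true
  | _, _ => false
  end.

Definition zigzag_shape : category.
Proof.
refine (@preorder_category zigzag_ob zigzag_le _ _).
- intros []; reflexivity.
- intros [] [] [] p q; solve [reflexivity | discriminate p | discriminate q].
Defined.

Lemma zigzag_finite : finite_category zigzag_shape.
Proof.
split.
- exists (zz_l :: zz_bl :: zz_m :: zz_br :: zz_r :: nil);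
  intros []; simpl; tauto.
- intros i j; apply Finite_is_true.
Qed.

Section Pullback.
Variables (A : fcp_category) (X Y Z : A) (f : hom X Z) (g : hom Y Z).

Definition cospan_fob (i : cospan_shape) : A :=
  match i with cs_left => X | cs_right => Y | cs_base => Z end.

Definition cospan_fmap (i j : cospan_shape) :
    hom i j -> hom (cospan_fob i) (cospan_fob j) :=
  match i, j return cospan_le i j = true ->
                    hom (cospan_fob i) (cospan_fob j) with
  | cs_left, cs_left => fun _ => idm X
  | cs_right, cs_right => fun _ => idm Y
  | cs_base, cs_base => fun _ => idm Z
  | cs_left, cs_base => fun _ => f
  | cs_right, cs_base => fun _ => g
  | _, _ => fun h => False_rect _ (diff_false_true h)
  end.

Definition cospan : functor cospan_shape A.
Proof.
refine (@Functor cospan_shape A cospan_fob cospan_fmap _ _).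
- intros []; reflexivity.
- intros [] [] [] u v; try discriminate u; try discriminate v; simpl;
  now rewrite ?comp1m, ?compm1.
Defined.

Definition pb_limit : limit cospan := fcp_lim cospan_finite cospan.
Definition pb : A := apex pb_limit.
Definition pb1 : hom pb X := leg pb_limit cs_left.
Definition pb2 : hom pb Y := leg pb_limit cs_right.

Lemma pb_square : pb1 · f = pb2 · g.
Proof.
transitivity (leg pb_limit cs_base).
- exact (leg_nat pb_limit (i := cs_left) (j := cs_base) eq_refl).
- symmetry; exact (leg_nat pb_limit (i := cs_right) (j := cs_base) eq_refl).
Qed.

Definition cospan_cone (W : A) (x : hom W X) (y : hom W Y)
    (h : x · f = y · g) : cone cospan.
Proof.
refine (@Cone _ _ cospan W (fun j : cospan_shape =>
  match j return hom W (cospan_fob j) with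
  | cs_left => x | cs_right => y | cs_base => x · f end) _).
intros [] [] u; try discriminate u; simpl; now rewrite ?compm1.
Defined.

Definition pb_pair (W : A) (x : hom W X) (y : hom W Y)
    (h : x · f = y · g) : hom W pb :=
  lim_lift pb_limit (cospan_cone h).

Lemma pb_pair1 (W : A) (x : hom W X) (y : hom W Y) (h : x · f = y · g) :
  pb_pair h · pb1 = x.
Proof. exact (lim_liftE pb_limit (cospan_cone h) cs_left). Qed.

Lemma pb_pair2 (W : A) (x : hom W X) (y : hom W Y) (h : x · f = y · g) :
  pb_pair h · pb2 = y.
Proof. exact (lim_liftE pb_limit (cospan_cone h) cs_right). Qed.

Lemma pb_uniq (W : A) (u v : hom W pb) :
  u · pb1 = v · pb1 -> u · pb2 = v · pb2 -> u = v.
Proof.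
intros h1 h2; apply (lim_uniq (l := pb_limit)); intros []; trivial.
pose proof (leg_nat pb_limit (i := cs_left) (j := cs_base) eq_refl) as e.
change (pb1 · f = leg pb_limit cs_base) in e.
now rewrite <- e, !compA, h1.
Qed.

End Pullback.

Section Zigzag.
Variables (A : fcp_category) (L Bl M Br R : A).
Variables (f : hom L Bl) (g : hom M Bl) (h : hom M Br) (k : hom R Br).

Definition zigzag_fob (i : zigzag_shape) : A :=
  match i with
  | zz_l => L | zz_bl => Bl | zz_m => M | zz_br => Br | zz_r => R
  end.

Definition zigzag_fmap (i j : zigzag_shape) :
    hom i j -> hom (zigzag_fob i) (zigzag_fob j) :=
  match i, j return zigzag_le i j = true ->
                    hom (zigzag_fob i) (zigzag_fob j) with
  | zz_l, zz_l => fun _ => idm L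
  | zz_bl, zz_bl => fun _ => idm Bl
  | zz_m, zz_m => fun _ => idm M
  | zz_br, zz_br => fun _ => idm Br
  | zz_r, zz_r => fun _ => idm R
  | zz_l, zz_bl => fun _ => f
  | zz_m, zz_bl => fun _ => g
  | zz_m, zz_br => fun _ => h
  | zz_r, zz_br => fun _ => k
  | _, _ => fun e => False_rect _ (diff_false_true e)
  end.

Definition zigzag : functor zigzag_shape A.
Proof.
refine (@Functor zigzag_shape A zigzag_fob zigzag_fmap _ _).
- intros []; reflexivity.
- intros [] [] [] u v; try discriminate u; try discriminate v; simpl;
  now rewrite ?comp1m, ?compm1.
Defined.

Definition zz_limit : limit zigzag := fcp_lim zigzag_finite zigzag.
Definition zz : A := apex zz_limit.
Definition zz1 : hom zz L := leg zz_limit zz_l.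
Definition zz2 : hom zz M := leg zz_limit zz_m.
Definition zz3 : hom zz R := leg zz_limit zz_r.

Lemma zz_square_l : zz1 · f = zz2 · g.
Proof.
transitivity (leg zz_limit zz_bl).
- exact (leg_nat zz_limit (i := zz_l) (j := zz_bl) eq_refl).
- symmetry; exact (leg_nat zz_limit (i := zz_m) (j := zz_bl) eq_refl).
Qed.

Lemma zz_square_r : zz2 · h = zz3 · k.
Proof.
transitivity (leg zz_limit zz_br).
- exact (leg_nat zz_limit (i := zz_m) (j := zz_br) eq_refl).
- symmetry; exact (leg_nat zz_limit (i := zz_r) (j := zz_br) eq_refl).
Qed.

Definition zigzag_cone (W : A) (x : hom W L) (y : hom W M) (z : hom W R)
    (exy : x · f = y · g) (eyz : y · h = z · k) : cone zigzag.
Proof.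
refine (@Cone _ _ zigzag W (fun j : zigzag_shape =>
  match j return hom W (zigzag_fob j) with
  | zz_l => x | zz_bl => x · f | zz_m => y | zz_br => y · h | zz_r => z
  end) _).
intros [] [] u; try discriminate u; simpl; now rewrite ?compm1.
Defined.

Definition zz_triple (W : A) (x : hom W L) (y : hom W M) (z : hom W R)
    (exy : x · f = y · g) (eyz : y · h = z · k) : hom W zz :=
  lim_lift zz_limit (zigzag_cone exy eyz).

Lemma zz_triple1 (W : A) (x : hom W L) (y : hom W M) (z : hom W R)
    (exy : x · f = y · g) (eyz : y · h = z · k) :
  zz_triple exy eyz · zz1 = x.
Proof. exact (lim_liftE zz_limit (zigzag_cone exy eyz) zz_l). Qed.

Lemma zz_triple2 (W : A) (x : hom W L) (y : hom W M) (z : hom W R)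
    (exy : x · f = y · g) (eyz : y · h = z · k) :
  zz_triple exy eyz · zz2 = y.
Proof. exact (lim_liftE zz_limit (zigzag_cone exy eyz) zz_m). Qed.

Lemma zz_triple3 (W : A) (x : hom W L) (y : hom W M) (z : hom W R)
    (exy : x · f = y · g) (eyz : y · h = z · k) :
  zz_triple exy eyz · zz3 = z.
Proof. exact (lim_liftE zz_limit (zigzag_cone exy eyz) zz_r). Qed.

Lemma zz_uniq (W : A) (u v : hom W zz) :
  u · zz1 = v · zz1 -> u · zz2 = v · zz2 -> u · zz3 = v · zz3 -> u = v.
Proof.
intros h1 h2 h3; apply (lim_uniq (l := zz_limit)); intros []; trivial.
- pose proof (leg_nat zz_limit (i := zz_l) (j := zz_bl) eq_refl) as e.
  change (zz1 · f = leg zz_limit zz_bl) in e.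
  now rewrite <- e, !compA, h1.
- pose proof (leg_nat zz_limit (i := zz_m) (j := zz_br) eq_refl) as e.
  change (zz2 · h = leg zz_limit zz_br) in e.
  now rewrite <- e, !compA, h2.
Qed.

End Zigzag.

Definition zero_of (A : fcp_category) : A := zob (fcp_zero A).
Definition from_zero (A : fcp_category) (X : A) : hom (zero_of A) X :=
  from_zob (fcp_zero A) X.

Lemma from_zero_uniq (A : fcp_category) (X : A) (f g : hom (zero_of A) X) :
  f = g.
Proof.
transitivity (from_zero X);
  [|symmetry]; apply (from_zob_uniq (z := fcp_zero A)).
Qed.

Definition ker (A : fcp_category) (X Y : A) (f : hom X Y) : A :=
  pb f (from_zero Y).
Definition ker_arr (A : fcp_category) (X Y : A) (f : hom X Y) :
    hom (ker f) X :=
  pb1 f (from_zero Y).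

Definition is_mono (C : category) (X Y : C) (f : hom X Y) : Prop :=
  forall (W : C) (u v : hom W X), u · f = v · f -> u = v.

Definition is_iso (C : category) (X Y : C) (f : hom X Y) : Prop :=
  exists g : hom Y X, f · g = idm X /\ g · f = idm Y.

Definition is_coequalizer (C : category) (R X Q : C) (u v : hom R X)
    (q : hom X Q) : Prop :=
  u · q = v · q /\
  forall (W : C) (g : hom X W), u · g = v · g ->
    exists! t : hom Q W, q · t = g.

Definition is_regular_epi (C : category) (X Y : C) (f : hom X Y) : Prop :=
  exists (R : C) (u v : hom R X), is_coequalizer u v f.

Definition is_jointly_strong_epi (C : category) (X Y Z : C)
    (f : hom X Z) (g : hom Y Z) : Prop :=
  forall (S : C) (s : hom S Z), is_mono s ->
    (exists f' : hom X S, f' · s = f) -> (exists g' : hom Y S, g' · s = g) ->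
    is_iso s.

Definition is_regular (A : fcp_category) : Prop :=
  (forall (X Y : A) (f : hom X Y),
     exists (Q : A) (q : hom X Q), is_coequalizer (pb1 f f) (pb2 f f) q) /\
  (forall (X Y Z : A) (f : hom X Z) (g : hom Y Z),
     is_regular_epi f -> is_regular_epi (pb2 f g)).

Record point (C : category) (Y : C) := Point {
  pt_ob : C;
  pt_arr : hom pt_ob Y;
  pt_sec : hom Y pt_ob;
  pt_secK : pt_sec · pt_arr = idm Y
}.

Record point_mor (C : category) (Y : C) (P Q : point Y) := PointMor {
  ptm :> hom (pt_ob P) (pt_ob Q);
  ptm_arr : ptm · pt_arr Q = pt_arr P;
  ptm_sec : pt_sec P · ptm = pt_sec Q
}.

Lemma change_of_base_proof (A : fcp_category) (X Y : A) (f : hom X Y)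
    (P Q : point Y) (h : point_mor P Q) :
  pb1 f (pt_arr P) · f = (pb2 f (pt_arr P) · h) · pt_arr Q.
Proof. now rewrite <- compA, ptm_arr, pb_square. Qed.

Definition change_of_base (A : fcp_category) (X Y : A) (f : hom X Y)
    (P Q : point Y) (h : point_mor P Q) :
    hom (pb f (pt_arr P)) (pb f (pt_arr Q)) :=
  pb_pair (change_of_base_proof f h).

(* The change-of-base functors of the fibration of points reflect isomorphisms.
   A morphism of points is invertible as such exactly when its underlying arrow
   is.  In the present pointed setting this condition is equivalent to the
   Split Short Five Lemma. *)
Definition is_protomodular (A : fcp_category) : Prop :=
  forall (X Y : A) (f : hom X Y) (P Q : point Y) (h : point_mor P Q),
    is_iso (change_of_base f h) -> is_iso h.

(* Equations between composites are stated on generalized elements x : W -> B1.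
   The hypotheses of the form (x · m) · c = z · d follow from the other axioms;
   they are quantified over only to make the pairings well typed. *)
Record groupoid (A : fcp_category) := Groupoid {
  g0 : A;
  g1 : A;
  gd : hom g1 g0;
  gc : hom g1 g0;
  ge : hom g0 g1;
  gm : hom (pb gc gd) g1;
  gi : hom g1 g1;
  ge_d : ge · gd = idm g0;
  ge_c : ge · gc = idm g0;
  gm_d : gm · gd = pb1 gc gd · gd;
  gm_c : gm · gc = pb2 gc gd · gc;
  gi_d : gi · gd = gc;
  gi_c : gi · gc = gd;
  gm_assoc : forall (W : A) (x y z : hom W g1)
    (hxy : x · gc = y · gd) (hyz : y · gc = z · gd)
    (hl : (pb_pair hxy · gm) · gc = z · gd)
    (hr : x · gc = (pb_pair hyz · gm) · gd),
    pb_pair hl · gm = pb_pair hr · gm;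
  gm_unitl : forall h : (gd · ge) · gc = idm g1 · gd,
    pb_pair h · gm = idm g1;
  gm_unitr : forall h : idm g1 · gc = (gc · ge) · gd,
    pb_pair h · gm = idm g1;
  gm_invr : forall h : idm g1 · gc = gi · gd, pb_pair h · gm = gd · ge;
  gm_invl : forall h : gi · gc = idm g1 · gd, pb_pair h · gm = gc · ge
}.

Record groupoid_functor (A : fcp_category) (G H : groupoid A) :=
  GroupoidFunctor {
  gf0 : hom (g0 G) (g0 H);
  gf1 : hom (g1 G) (g1 H);
  gf_d : gf1 · gd H = gd G · gf0;
  gf_c : gf1 · gc H = gc G · gf0;
  gf_e : ge G · gf1 = gf0 · ge H;
  gf_m : forall h : (pb1 (gc G) (gd G) · gf1) · gc H =
                    (pb2 (gc G) (gd G) · gf1) · gd H,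
    gm G · gf1 = pb_pair h · gm H;
  gf_i : gi G · gf1 = gf1 · gi H
}.

Section FunctorClasses.
Variables (A : fcp_category) (G H : groupoid A) (F : groupoid_functor G H).

Definition gf_partial0 :
    hom (g1 G) (zz (gf0 F) (gd H) (gc H) (gf0 F)) :=
  zz_triple (eq_sym (gf_d F)) (gf_c F).

Definition gf_tau : hom (g1 G) (pb (gf0 F) (gd H)) :=
  pb_pair (eq_sym (gf_d F)).

Definition gf_faithful : Prop := is_mono gf_partial0.
Definition gf_fully_faithful : Prop := is_iso gf_partial0.
Definition gf_full : Prop := is_regular_epi gf_partial0.
Definition gf_essentially_surjective : Prop :=
  is_regular_epi (pb2 (gf0 F) (gd H) · gc H).
Definition gf_fibration : Prop := is_regular_epi gf_tau.

End FunctorClasses.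

Record arrow (C : category) := Arrow {
  arr_dom : C;
  arr_cod : C;
  arr_mor :> hom arr_dom arr_cod
}.

Record arrow_mor (C : category) (a b : arrow C) := ArrowMor {
  am : hom (arr_dom a) (arr_dom b);
  am0 : hom (arr_cod a) (arr_cod b);
  am_square : am · b = a · am0
}.

Section ArrowClasses.
Variables (A : fcp_category) (a b : arrow A) (f : arrow_mor a b).

Definition am_partial0 : hom (arr_dom a) (pb (am0 f) b) :=
  pb_pair (eq_sym (am_square f)).

Definition am_faithful : Prop := is_mono am_partial0.
Definition am_fully_faithful : Prop := is_iso am_partial0.
Definition am_full : Prop := is_regular_epi am_partial0.
Definition am_essentially_surjective : Prop :=
  is_jointly_strong_epi (am0 f) b.
Definition am_fibration : Prop := is_regular_epi (am f).

End ArrowClasses.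

Section Normalization.
Variable A : fcp_category.

Definition norm_ob (G : groupoid A) : arrow A :=
  Arrow (ker_arr (gd G) · gc G).

Variables (G H : groupoid A) (F : groupoid_functor G H).

Lemma norm_ker_proof :
  (ker_arr (gd G) · gf1 F) · gd H =
  pb2 (gd G) (from_zero (g0 G)) · from_zero (g0 H).
Proof.
unfold ker_arr, ker.
rewrite <- compA, gf_d, compA, pb_square, <- compA.
now rewrite (from_zero_uniq (from_zero (g0 G) · gf0 F) (from_zero (g0 H))).
Qed.

Definition norm_ker : hom (ker (gd G)) (ker (gd H)) := pb_pair norm_ker_proof.

Lemma norm_kerE : norm_ker · ker_arr (gd H) = ker_arr (gd G) · gf1 F.
Proof. apply pb_pair1. Qed.

Lemma norm_square : norm_ker · norm_ob H = norm_ob G · gf0 F.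
Proof.
simpl; rewrite compA, norm_kerE, <- !compA; now rewrite gf_c.
Qed.

Definition norm_mor : arrow_mor (norm_ob G) (norm_ob H) :=
  @ArrowMor _ (norm_ob G) (norm_ob H) norm_ker (gf0 F) norm_square.

End Normalization.

(* Main.v *)
Require Import Defs.

Set Implicit Arguments.
Unset Strict Implicit.
Unset Printing Implicit Defensive.

(** Both comparison arrows of a functor [F : G -> H] live over the object of
    objects [g0 G]: [gf_partial0 F] goes from the domain map [gd G] to the first
    projection [zz1] of the zigzag limit, and [gf_tau F] goes from [gd G] to the
    first projection of the pullback of [gf0 F] and [gd H].  Passing to kernels
    of these three maps to [g0 G], [gf_partial0 F] restricts to
    [am_partial0 (norm_mor F)] and [gf_tau F] restricts to [norm_ker F].  So
    every clause, except the two on essential surjectivity, compares an arrow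
    [h] over a base with its restriction [h'] to kernels ([kernel_square]).

    From [h] to [h']: the kernel inclusions make [h'] a pullback of [h]
    ([kernel_square_pullback]), and monomorphisms, isomorphisms and, in a regular
    category, regular epimorphisms are stable under pullback.

    From [h'] to [h]: the identities [ge G] split [gd G], so the arrows [h] are
    arrows of points.  Protomodularity then gives the Split Short Five Lemma
    ([split_short_five]), which is the reflection of isomorphisms, and its
    consequence that the section and the kernel of a split epimorphism are
    jointly strongly epimorphic ([section_kernel_jointly_strong_epi]).  Applied
    to the diagonal of the kernel pair of [h] it reflects monomorphisms; applied
    to the image of [h] it reflects regular epimorphisms.

    For essential surjectivity, let [E] be the pullback of [gf0 F] and [gd H],
    with its arrow [E -> g0 H] to codomains.  Restricted to the section
    [g0 G -> E] given by identities, this arrow is [gf0 F]; restricted to the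
    kernel of [E -> g0 G], which is the kernel of [gd H], it is [norm_ob H].
    Hence a subobject of [g0 H] through which [E -> g0 H] factors contains both
    [gf0 F] and [norm_ob H], and in the protomodular case the converse holds
    because the section and the kernel are jointly strongly epimorphic. *)

(** * Zero arrows, kernels and pullbacks *)

Definition zero_mor (A : fcp_category) (X Y : A) : hom X Y :=
  to_zob (fcp_zero A) X · from_zero Y.
Arguments zero_mor {A} X Y.

Lemma to_zero_eq (A : fcp_category) (X : A) (f g : hom X (zero_of A)) : f = g.
Proof.
transitivity (to_zob (fcp_zero A) X); [|symmetry]; apply to_zob_uniq.
Qed.

Lemma factor_zero (A : fcp_category) (X Y : A) (f : hom X (zero_of A)) :
  f · from_zero Y = zero_mor X Y.
Proof. unfold zero_mor; f_equal; apply to_zero_eq. Qed.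

Lemma zero_comp (A : fcp_category) (X Y Z : A) (f : hom Y Z) :
  zero_mor X Y · f = zero_mor X Z.
Proof.
unfold zero_mor; rewrite <- compA; f_equal; apply from_zero_uniq.
Qed.

Lemma comp_zero (A : fcp_category) (X Y Z : A) (f : hom X Y) :
  f · zero_mor Y Z = zero_mor X Z.
Proof. unfold zero_mor at 1; rewrite compA; apply factor_zero. Qed.

Record is_kernel (A : fcp_category) (K X Y : A) (k : hom K X) (f : hom X Y) :
    Prop := IsKernel {
  kernel_zero : k · f = zero_mor K Y;
  kernel_mono : is_mono k;
  kernel_lift : forall (W : A) (x : hom W X), x · f = zero_mor W Y ->
    exists u, u · k = x
}.

Record is_pullback (C : category) (P X Y Z : C) (p1 : hom P X) (p2 : hom P Y)
    (f : hom X Z) (g : hom Y Z) : Prop := IsPullback {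
  pullback_comm : p1 · f = p2 · g;
  pullback_uniq : forall (W : C) (u v : hom W P),
    u · p1 = v · p1 -> u · p2 = v · p2 -> u = v;
  pullback_lift : forall (W : C) (x : hom W X) (y : hom W Y), x · f = y · g ->
    exists u, u · p1 = x /\ u · p2 = y
}.

Lemma ker_arr_kernel (A : fcp_category) (X Y : A) (f : hom X Y) :
  is_kernel (ker_arr f) f.
Proof.
split.
- unfold ker_arr, ker; rewrite pb_square; apply factor_zero.
- intros W u v e; apply pb_uniq; [exact e | apply to_zero_eq].
- intros W x e; exists (pb_pair (f := f) (g := from_zero Y) e).
  apply pb_pair1.
Qed.

(** The projections are swapped with respect to [ker_arr]: this is the form in
    which the kernel of a point occurs as a change of base to zero. *)
Lemma pb2_from_zero_kernel (A : fcp_category) (X Y : A) (f : hom X Y) :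
  is_kernel (pb2 (from_zero Y) f) f.
Proof.
split.
- rewrite <- pb_square; apply factor_zero.
- intros W u v e; apply pb_uniq; [apply to_zero_eq | exact e].
- intros W x e.
  exists (pb_pair (f := from_zero Y) (g := f) (eq_sym e)).
  apply pb_pair2.
Qed.

(** * Isomorphisms, regular epimorphisms and images *)

Lemma is_iso_idm (C : category) (X : C) : is_iso (idm X).
Proof. exists (idm X); split; apply comp1m. Qed.

Lemma is_iso_comp (C : category) (X Y Z : C) (f : hom X Y) (g : hom Y Z) :
  is_iso f -> is_iso g -> is_iso (f · g).
Proof.
intros [f' [ff' f'f]] [g' [gg' g'g]]; exists (g' · f'); split.
- now rewrite compA, <- (compA f), gg', compm1.
- now rewrite compA, <- (compA g'), f'f, compm1.
Qed.

Lemma mono_split_epi_iso (C : category) (X Y : C) (m : hom X Y) (t : hom Y X) :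
  is_mono m -> t · m = idm Y -> is_iso m.
Proof.
intros hm tm; exists t; split; [|exact tm].
apply hm; now rewrite <- compA, tm, compm1, comp1m.
Qed.

Lemma kernels_iso (A : fcp_category) (K L X Y : A) (f : hom X Y)
    (k : hom K X) (l : hom L X) :
  is_kernel k f -> is_kernel l f -> exists i, is_iso i /\ i · l = k.
Proof.
intros kk kl.
destruct (kernel_lift kl (kernel_zero kk)) as [i hi].
destruct (kernel_lift kk (kernel_zero kl)) as [j hj].
exists i; split; [|exact hi]; exists j; split.
- apply (kernel_mono kk); now rewrite <- compA, hj, hi, comp1m.
- apply (kernel_mono kl); now rewrite <- compA, hi, hj, comp1m.
Qed.

Lemma regular_epi_epi (C : category) (X Y Z : C) (f : hom X Y)
    (s t : hom Y Z) :
  is_regular_epi f -> f · s = f · t -> s = t.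
Proof.
intros [R [u [v [e huniv]]]] est.
destruct (huniv Z (f · s)) as [w [_ hw]]; [now rewrite !compA, e|].
now rewrite <- (hw s eq_refl), <- (hw t (eq_sym est)).
Qed.

Lemma regular_epi_comp_iso (C : category) (X Y Z : C) (f : hom X Y)
    (i : hom Y Z) :
  is_regular_epi f -> is_iso i -> is_regular_epi (f · i).
Proof.
intros [R [u [v [e huniv]]]] [j [ij ji]]; exists R, u, v; split.
- now rewrite !compA, e.
- intros W g eg; destruct (huniv W g eg) as [t [ft ht]].
  exists (j · t); split.
  + now rewrite compA, <- (compA f), ij, compm1.
  + intros t' ft'; rewrite (ht (i · t')); [|now rewrite compA].
    now rewrite compA, ji, comp1m.
Qed.

Lemma iso_comp_regular_epi (C : category) (X Y Z : C) (i : hom X Y)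
    (f : hom Y Z) :
  is_iso i -> is_regular_epi f -> is_regular_epi (i · f).
Proof.
intros [j [ij ji]] [R [u [v [e huniv]]]]; exists R, (u · j), (v · j); split.
- now rewrite !compA, <- !(compA _ j i), ji, !compm1.
- intros W g eg; destruct (huniv W (j · g)) as [t [ft ht]].
  + now rewrite !compA.
  + exists t; split.
    * now rewrite <- compA, ft, compA, ij, comp1m.
    * intros t' ft'; apply ht.
      now rewrite <- ft', !compA, ji, comp1m.
Qed.

(** Regular epimorphisms are strong: if [e · x] lands in a subobject, then so
    does [x], because the factorization of [e · x] coequalizes the pair of which
    [e] is the coequalizer. *)
Lemma regular_epi_factor (C : category) (X Y Z S : C) (e : hom X Y)
    (x : hom Y Z) (m : hom S Z) (y : hom X S) :
  is_regular_epi e -> is_mono m -> y · m = e · x -> exists t, t · m = x.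
Proof.
intros he hm eq; pose proof he as [R [u [v [euv huniv]]]].
destruct (huniv S y) as [t [et _]].
- apply hm; now rewrite <- !compA, eq, !compA, euv.
- exists t; apply (regular_epi_epi he); now rewrite compA, et.
Qed.

Lemma regular_epi_mono_iso (C : category) (X Y S : C) (q : hom X S)
    (m : hom S Y) :
  is_regular_epi (q · m) -> is_mono m -> is_iso m.
Proof.
intros he hm.
destruct (regular_epi_factor (x := idm Y) (y := q) he hm) as [t ht].
- symmetry; apply compm1.
- exact (mono_split_epi_iso hm ht).
Qed.

Lemma kernel_pair_coequal (A : fcp_category) (W X Y Z : A) (f : hom X Y)
    (g : hom X Z) (x y : hom W X) :
  pb1 f f · g = pb2 f f · g -> x · f = y · f -> x · g = y · g.
Proof.
intros eg e; transitivity (pb_pair e · pb1 f f · g).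
- now rewrite pb_pair1.
- now rewrite <- compA, eg, compA, pb_pair2.
Qed.

(** The image of [f] is the coequalizer [q] of its kernel pair.  To see that the
    induced [m] is monic, take [u] and [v] with [u · m = v · m]: after pulling
    back along [q] twice, which only costs precomposition with regular
    epimorphisms, [u] and [v] lift to arrows identified by [f], hence by [q]. *)
Lemma image_factorization (A : fcp_category) (X Y : A) (f : hom X Y) :
  is_regular A ->
  exists (I : A) (q : hom X I) (m : hom I Y),
    is_regular_epi q /\ is_mono m /\ q · m = f.
Proof.
intros [hcoeq hstable].
destruct (hcoeq X Y f) as [I [q hq]].
assert (req : is_regular_epi q).
{ exists (pb f f), (pb1 f f), (pb2 f f); exact hq. }
destruct hq as [eq huniv].
destruct (huniv Y f (pb_square f f)) as [m [qm _]].
exists I, q, m; split; [exact req|split; [|exact qm]].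
intros W u v euv.
set (w1 := pb2 q u); set (w2 := pb2 q (w1 · v)).
apply (regular_epi_epi (f := w1)); [apply hstable, req|].
apply (regular_epi_epi (f := w2)); [apply hstable, req|].
set (x := w2 · pb1 q u); set (y := pb1 q (w1 · v)).
assert (ex : x · q = w2 · (w1 · u)).
{ unfold x, w1; now rewrite <- compA, pb_square. }
assert (ey : y · q = w2 · (w1 · v)) by apply pb_square.
assert (exy : x · f = y · f).
{ now rewrite <- qm, !compA, ex, ey, <- !compA, euv. }
rewrite <- ex, <- ey.
exact (kernel_pair_coequal eq exy).
Qed.

(** A subobject containing [f · x] and [g · x] contains [x]: pull it back along
    [x]. *)
Lemma jointly_strong_epi_factor (A : fcp_category) (X Y Z T S : A)
    (f : hom X Z) (g : hom Y Z) (x : hom Z T) (m : hom S T)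
    (f' : hom X S) (g' : hom Y S) :
  is_jointly_strong_epi f g -> is_mono m ->
  f' · m = f · x -> g' · m = g · x -> exists t, t · m = x.
Proof.
intros hfg hm ef eg.
destruct (hfg (pb m x) (pb2 m x)) as [j [_ hj]].
- intros W u v e; apply pb_uniq; [|exact e].
  apply hm; now rewrite <- !compA, pb_square, !compA, e.
- exists (pb_pair ef); apply pb_pair2.
- exists (pb_pair eg); apply pb_pair2.
- exists (j · pb1 m x).
  now rewrite <- compA, pb_square, compA, hj, comp1m.
Qed.

(** * Stability under pullback *)

Section PullbackStability.
Variables (A : fcp_category) (P X Y Z : A).
Variables (p1 : hom P X) (p2 : hom P Y) (f : hom X Z) (g : hom Y Z).
Hypothesis hpb : is_pullback p1 p2 f g.

Lemma pullback_mono : is_mono f -> is_mono p2.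
Proof.
intros hf W u v e; apply (pullback_uniq hpb); [|exact e].
apply hf; now rewrite <- !compA, (pullback_comm hpb), !compA, e.
Qed.

Lemma pullback_iso : is_iso f -> is_iso p2.
Proof.
intros [j [fj jf]].
destruct (pullback_lift hpb (x := g · j) (y := idm Y)) as [t [t1 t2]].
- now rewrite <- compA, jf, compm1, comp1m.
- exists t; split; [|exact t2]; apply (pullback_uniq hpb).
  + rewrite <- compA, t1, compA, <- (pullback_comm hpb), <- compA, fj.
    now rewrite compm1, comp1m.
  + now rewrite <- compA, t2, compm1, comp1m.
Qed.

Lemma pullback_regular_epi :
  is_regular A -> is_regular_epi f -> is_regular_epi p2.
Proof.
intros [_ hstable] hf.
pose (i := pb_pair (pullback_comm hpb)).
assert (i1 : i · pb1 f g = p1) by apply pb_pair1.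
assert (i2 : i · pb2 f g = p2) by apply pb_pair2.
rewrite <- i2; apply iso_comp_regular_epi; [|now apply hstable].
destruct (pullback_lift hpb (pb_square f g)) as [j [j1 j2]].
exists j; split.
- apply (pullback_uniq hpb); now rewrite <- compA, ?j1, ?j2, comp1m.
- apply pb_uniq; now rewrite <- compA, ?i1, ?i2, comp1m.
Qed.

End PullbackStability.

(** * Restriction of an arrow over a base to kernels *)

Record kernel_square (A : fcp_category) (Z X Y K L : A) (p : hom X Z)
    (q : hom Y Z) (h : hom X Y) (k : hom K X) (l : hom L Y) (h' : hom K L) :
    Prop := KernelSquare {
  ks_over : h · q = p;
  ks_dom : is_kernel k p;
  ks_cod : is_kernel l q;
  ks_comm : k · h = h' · l
}.

(** An element [x] of [X] with [x · h] in the kernel of [q] is killed by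
    [p = h · q], so it already lies in the kernel of [p]. *)
Lemma kernel_square_pullback (A : fcp_category) (Z X Y K L : A) (p : hom X Z)
    (q : hom Y Z) (h : hom X Y) (k : hom K X) (l : hom L Y) (h' : hom K L) :
  kernel_square p q h k l h' -> is_pullback k h' h l.
Proof.
intros [over kk kl comm]; split.
- exact comm.
- intros W u v e _; exact (kernel_mono kk e).
- intros W x y e; destruct (kernel_lift kk (x := x)) as [u hu].
  + now rewrite <- over, compA, e, <- compA, (kernel_zero kl), comp_zero.
  + exists u; split; [exact hu|].
    apply (kernel_mono kl); now rewrite <- compA, <- comm, compA, hu.
Qed.

(** Change of base along the arrow from zero is the restriction to kernels, up to
    the isomorphisms between chosen kernels.  The section of [q] is [s · h]. *)
Lemma split_short_five (A : fcp_category) (Z X Y K L : A) (p : hom X Z)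
    (q : hom Y Z) (h : hom X Y) (k : hom K X) (l : hom L Y) (h' : hom K L)
    (s : hom Z X) :
  is_protomodular A -> s · p = idm Z -> kernel_square p q h k l h' ->
  is_iso h' -> is_iso h.
Proof.
intros hproto sp [over kk kl comm] iso'.
assert (tq : (s · h) · q = idm Z) by now rewrite <- compA, over.
pose (P := Point sp); pose (Q := Point tq).
pose (hPQ := @PointMor A Z P Q h over eq_refl).
apply (hproto _ _ (from_zero Z) P Q hPQ).
destruct (kernels_iso (pb2_from_zero_kernel p) kk) as [a [ia ea]].
destruct (kernels_iso kl (pb2_from_zero_kernel q)) as [b [ib eb]].
replace (change_of_base (from_zero Z) hPQ) with (a · h' · b).
- now repeat apply is_iso_comp.
- apply pb_uniq; [apply to_zero_eq|].
  unfold change_of_base; rewrite pb_pair2; simpl.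
  now rewrite <- compA, eb, <- compA, <- comm, compA, ea.
Qed.

(** A subobject [S] containing both the section and the kernel is again split
    over [Z], with the same kernel, so the Split Short Five Lemma applies to its
    inclusion. *)
Lemma section_kernel_jointly_strong_epi (A : fcp_category) (Z X K : A)
    (p : hom X Z) (s : hom Z X) (k : hom K X) :
  is_protomodular A -> s · p = idm Z -> is_kernel k p ->
  is_jointly_strong_epi s k.
Proof.
intros hproto sp kk S m hm [s' es] [k' ek].
apply (split_short_five (p := m · p) (q := p) (k := k') (l := k)
         (h' := idm K) (s := s')); trivial.
- now rewrite compA, es.
- split; trivial; [|now rewrite comp1m].
  split.
  + now rewrite compA, ek, (kernel_zero kk).
  + intros W u v e; apply (kernel_mono kk); now rewrite <- ek, !compA, e.
  + intros W x e; rewrite compA in e.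
    destruct (kernel_lift kk e) as [u hu]; exists u.
    apply hm; now rewrite <- compA, ek.
- apply is_iso_idm.
Qed.

(** The kernel pair of [h] is split over the base by the diagonal composed with
    [s].  Its kernel consists of pairs of elements of [K] identified by [h'], so
    it lies on the diagonal when [h'] is monic; then the diagonal, containing
    section and kernel, is the whole kernel pair. *)
Lemma kernel_square_reflects_mono (A : fcp_category) (Z X Y K L : A)
    (p : hom X Z) (q : hom Y Z) (h : hom X Y) (k : hom K X) (l : hom L Y)
    (h' : hom K L) (s : hom Z X) :
  is_protomodular A -> s · p = idm Z -> kernel_square p q h k l h' ->
  is_mono h' -> is_mono h.
Proof.
intros hproto sp [over kk kl comm] mono'.
pose (r1 := pb1 h h); pose (r2 := pb2 h h).
assert (r12 : r1 · h = r2 · h) by apply pb_square.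
pose (diag := pb_pair (eq_refl (idm X · h))).
assert (d1 : diag · r1 = idm X) by apply pb_pair1.
assert (d2 : diag · r2 = idm X) by apply pb_pair2.
assert (r2p : r2 · p = r1 · p) by now rewrite <- over, !compA, r12.
pose (n := ker_arr (r1 · p)).
assert (hn : is_kernel n (r1 · p)) by apply ker_arr_kernel.
assert (iso_diag : is_iso diag).
{ apply (section_kernel_jointly_strong_epi (p := r1 · p) (s := s · diag)
           (k := n)); trivial.
  - now rewrite compA, <- (compA s), d1, compm1.
  - intros W u v e.
    now rewrite <- (compm1 u), <- (compm1 v), <- d1, !compA, e.
  - now exists s.
  - destruct (kernel_lift kk (x := n · r1)) as [a ha].
    { rewrite <- compA; apply (kernel_zero hn). }
    destruct (kernel_lift kk (x := n · r2)) as [b hb].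
    { rewrite <- compA, r2p; apply (kernel_zero hn). }
    assert (ab : a = b).
    { apply mono', (kernel_mono kl).
      now rewrite <- !compA, <- comm, !compA, ha, hb, <- !compA, r12. }
    exists (a · k); apply pb_uniq.
    + change ((a · k) · diag · r1 = n · r1).
      now rewrite <- compA, d1, compm1.
    + change ((a · k) · diag · r2 = n · r2).
      now rewrite <- compA, d2, compm1, ab. }
destruct iso_diag as [j [_ jd]].
assert (er : r1 = r2).
{ rewrite <- (comp1m r1), <- (comp1m r2), <- jd, <- !compA.
  now rewrite d1, d2. }
intros W u v e; rewrite <- (compm1 u), <- (compm1 v).
apply (kernel_pair_coequal (f := h)); [|exact e].
now rewrite !compm1.
Qed.

(** The image of [h] contains the section [s · h] of [q], and it contains the
    kernel [l] of [q] as soon as [h'], whose composite with [l] factors through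
    [h], is a regular epimorphism. *)
Lemma kernel_square_reflects_regular_epi (A : fcp_category) (Z X Y K L : A)
    (p : hom X Z) (q : hom Y Z) (h : hom X Y) (k : hom K X) (l : hom L Y)
    (h' : hom K L) (s : hom Z X) :
  is_regular A -> is_protomodular A -> s · p = idm Z ->
  kernel_square p q h k l h' -> is_regular_epi h' -> is_regular_epi h.
Proof.
intros hreg hproto sp [over kk kl comm] epi'.
destruct (image_factorization h hreg) as [I [e [m [he [hm em]]]]].
rewrite <- em; apply regular_epi_comp_iso; [exact he|].
apply (section_kernel_jointly_strong_epi (p := q) (s := s · h) (k := l));
  trivial.
- now rewrite <- compA, over.
- exists (s · e); now rewrite <- compA, em.
- apply (regular_epi_factor (y := k · e) epi' hm).
  now rewrite <- comm, <- em, compA.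
Qed.

(** * The kernel squares of an internal functor *)

Section NormalizationSquares.
Variables (A : fcp_category) (G H : groupoid A) (F : groupoid_functor G H).

Lemma tau_ker_proof :
  zero_mor (ker (gd H)) (g0 G) · gf0 F = ker_arr (gd H) · gd H.
Proof. now rewrite zero_comp, (kernel_zero (ker_arr_kernel _)). Qed.

(** The kernel of a pullback projection is the kernel of the arrow pulled back. *)
Definition tau_ker : hom (ker (gd H)) (pb (gf0 F) (gd H)) :=
  pb_pair tau_ker_proof.

Lemma tau_ker1 : tau_ker · pb1 (gf0 F) (gd H) = zero_mor _ _.
Proof. apply pb_pair1. Qed.

Lemma tau_ker2 : tau_ker · pb2 (gf0 F) (gd H) = ker_arr (gd H).
Proof. apply pb_pair2. Qed.

Lemma tau_ker_kernel : is_kernel tau_ker (pb1 (gf0 F) (gd H)).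
Proof.
pose proof (ker_arr_kernel (gd H)) as kH; split.
- apply tau_ker1.
- intros W u v e; apply (kernel_mono kH).
  now rewrite <- tau_ker2, !compA, e.
- intros W x e.
  destruct (kernel_lift kH (x := x · pb2 (gf0 F) (gd H))) as [u hu].
  + now rewrite <- compA, <- pb_square, compA, e, zero_comp.
  + exists u; apply pb_uniq.
    * now rewrite <- compA, tau_ker1, e, comp_zero.
    * now rewrite <- compA, tau_ker2.
Qed.

Lemma tau_kernel_square :
  kernel_square (gd G) (pb1 (gf0 F) (gd H)) (gf_tau F) (ker_arr (gd G))
    tau_ker (norm_ker F).
Proof.
split.
- apply pb_pair1.
- apply ker_arr_kernel.
- apply tau_ker_kernel.
- apply pb_uniq.
  + rewrite <- !compA, tau_ker1, comp_zero.
    unfold gf_tau; rewrite pb_pair1; apply (kernel_zero (ker_arr_kernel _)).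
  + rewrite <- !compA, tau_ker2, norm_kerE.
    unfold gf_tau; now rewrite pb_pair2.
Qed.

Lemma partial0_ker_proof_l :
  zero_mor (pb (gf0 F) (norm_ob H)) (g0 G) · gf0 F =
  (pb2 (gf0 F) (norm_ob H) · ker_arr (gd H)) · gd H.
Proof.
rewrite zero_comp, <- compA; simpl.
now rewrite (kernel_zero (ker_arr_kernel _)), comp_zero.
Qed.

Lemma partial0_ker_proof_r :
  (pb2 (gf0 F) (norm_ob H) · ker_arr (gd H)) · gc H =
  pb1 (gf0 F) (norm_ob H) · gf0 F.
Proof. rewrite <- compA; symmetry; apply pb_square. Qed.

(** The kernel of [zz1] consists of the arrows of [H] out of the zero object
    together with an object of [G] over their codomain. *)
Definition partial0_ker :
    hom (pb (gf0 F) (norm_ob H)) (zz (gf0 F) (gd H) (gc H) (gf0 F)) :=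
  zz_triple partial0_ker_proof_l partial0_ker_proof_r.

Lemma partial0_ker1 : partial0_ker · zz1 _ _ _ _ = zero_mor _ _.
Proof. apply zz_triple1. Qed.

Lemma partial0_ker2 :
  partial0_ker · zz2 _ _ _ _ = pb2 (gf0 F) (norm_ob H) · ker_arr (gd H).
Proof. apply zz_triple2. Qed.

Lemma partial0_ker3 : partial0_ker · zz3 _ _ _ _ = pb1 (gf0 F) (norm_ob H).
Proof. apply zz_triple3. Qed.

Lemma partial0_ker_kernel :
  is_kernel partial0_ker (zz1 (gf0 F) (gd H) (gc H) (gf0 F)).
Proof.
pose proof (ker_arr_kernel (gd H)) as kH; split.
- apply partial0_ker1.
- intros W u v e; apply pb_uniq.
  + now rewrite <- partial0_ker3, !compA, e.
  + apply (kernel_mono kH).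
    now rewrite <- !compA, <- partial0_ker2, !compA, e.
- intros W x e.
  destruct (kernel_lift kH (x := x · zz2 _ _ _ _)) as [u hu].
  + now rewrite <- compA, <- zz_square_l, compA, e, zero_comp.
  + assert (ex : (x · zz3 _ _ _ _) · gf0 F = u · norm_ob H).
    { simpl; now rewrite compA, hu, <- !compA, zz_square_r. }
    exists (pb_pair ex); apply zz_uniq.
    * now rewrite <- compA, partial0_ker1, comp_zero.
    * now rewrite <- compA, partial0_ker2, compA, pb_pair2.
    * now rewrite <- compA, partial0_ker3, pb_pair1.
Qed.

Lemma partial0_kernel_square :
  kernel_square (gd G) (zz1 (gf0 F) (gd H) (gc H) (gf0 F)) (gf_partial0 F)
    (ker_arr (gd G)) partial0_ker (am_partial0 (norm_mor F)).
Proof.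
split.
- apply zz_triple1.
- apply ker_arr_kernel.
- apply partial0_ker_kernel.
- apply zz_uniq; rewrite <- !compA.
  + rewrite partial0_ker1, comp_zero.
    unfold gf_partial0; rewrite zz_triple1.
    apply (kernel_zero (ker_arr_kernel _)).
  + rewrite partial0_ker2; unfold gf_partial0; rewrite zz_triple2.
    rewrite <- norm_kerE.
    transitivity (am_partial0 (norm_mor F) · pb2 (gf0 F) (norm_ob H)
                    · ker_arr (gd H)).
    * f_equal; symmetry; apply pb_pair2.
    * symmetry; apply compA.
  + rewrite partial0_ker3; unfold gf_partial0; rewrite zz_triple3.
    symmetry; apply pb_pair1.
Qed.

(** * Essential surjectivity *)

Lemma tau_sec_proof : idm (g0 G) · gf0 F = (gf0 F · ge H) · gd H.
Proof. now rewrite <- compA, ge_d, compm1, comp1m. Qed.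

(** An object [a] of [G] together with the identity arrow of its image. *)
Definition tau_sec : hom (g0 G) (pb (gf0 F) (gd H)) := pb_pair tau_sec_proof.

Lemma tau_sec1 : tau_sec · pb1 _ _ = idm (g0 G).
Proof. apply pb_pair1. Qed.

Lemma tau_sec_cod : tau_sec · (pb2 _ _ · gc H) = gf0 F.
Proof.
unfold tau_sec; now rewrite compA, pb_pair2, <- compA, ge_c, compm1.
Qed.

Lemma tau_ker_cod : tau_ker · (pb2 _ _ · gc H) = norm_ob H.
Proof. now rewrite compA, tau_ker2. Qed.

Lemma norm_essentially_surjective :
  is_protomodular A -> gf_essentially_surjective F ->
  am_essentially_surjective (norm_mor F).
Proof.
intros hproto hF S s hs [f' ef] [g' eg]; simpl in s, f', ef, g', eg.
pose proof (section_kernel_jointly_strong_epi hproto tau_sec1 tau_ker_kernel)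
  as hE.
destruct (jointly_strong_epi_factor (x := pb2 _ _ · gc H) (f' := f')
            (g' := g') hE hs) as [t ht].
- now rewrite tau_sec_cod.
- now rewrite tau_ker_cod.
- red in hF; rewrite <- ht in hF; exact (regular_epi_mono_iso hF hs).
Qed.

Lemma essentially_surjective_of_norm :
  is_regular A -> am_essentially_surjective (norm_mor F) ->
  gf_essentially_surjective F.
Proof.
intros hreg hN; unfold gf_essentially_surjective.
destruct (image_factorization (pb2 (gf0 F) (gd H) · gc H) hreg)
  as [I [q [m [hq [hm qm]]]]].
rewrite <- qm; apply regular_epi_comp_iso; [exact hq|].
apply hN; [exact hm| |].
- exists (tau_sec · q).
  transitivity (tau_sec · (q · m)); [symmetry; apply compA|].
  rewrite qm; apply tau_sec_cod.
- exists (tau_ker · q).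
  transitivity (tau_ker · (q · m)); [symmetry; apply compA|].
  rewrite qm; apply tau_ker_cod.
Qed.

End NormalizationSquares.

(** * Comparing a functor with its normalization *)

Theorem proposition5p14 (A : fcp_category) (G H : groupoid A)
    (F : groupoid_functor G H) :
  (gf_faithful F -> am_faithful (norm_mor F)) /\
  (gf_fully_faithful F -> am_fully_faithful (norm_mor F)) /\
  (is_regular A -> gf_full F -> am_full (norm_mor F)) /\
  (is_protomodular A -> am_faithful (norm_mor F) -> gf_faithful F) /\
  (is_protomodular A -> am_fully_faithful (norm_mor F) ->
     gf_fully_faithful F) /\
  (is_regular A -> is_protomodular A -> am_full (norm_mor F) -> gf_full F) /\
  (is_regular A -> is_protomodular A -> gf_essentially_surjective F ->
     am_essentially_surjective (norm_mor F)) /\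
  (is_regular A -> am_essentially_surjective (norm_mor F) ->
     gf_essentially_surjective F) /\
  (is_regular A -> gf_fibration F -> am_fibration (norm_mor F)) /\
  (is_regular A -> is_protomodular A -> am_fibration (norm_mor F) ->
     gf_fibration F).
Proof.
pose proof (partial0_kernel_square F) as sq.
pose proof (tau_kernel_square F) as sqt.
pose proof (kernel_square_pullback sq) as pbk.
pose proof (kernel_square_pullback sqt) as pbt.
pose proof (ge_d G) as ed.
repeat split.
- exact (pullback_mono pbk).
- exact (pullback_iso pbk).
- exact (pullback_regular_epi pbk).
- intros hproto; exact (kernel_square_reflects_mono hproto ed sq).
- intros hproto; exact (split_short_five hproto ed sq).
- intros hreg hproto.
  exact (kernel_square_reflects_regular_epi hreg hproto ed sq).
- intros _; apply norm_essentially_surjective.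
- apply essentially_surjective_of_norm.
- exact (pullback_regular_epi pbt).
- intros hreg hproto.
  exact (kernel_square_reflects_regular_epi hreg hproto ed sqt).
Qed.
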